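(* Let $(X,\xi)$ be a convergence space, $A\subset X$, and let $\mathcal{F}$ be a filter on $X$. Let $\mathbb{D}$ be a composable class of filters. The following are equivalent: (1) $\mathcal{F}$ is $\mathbb{D}$-compact at $A$; (2) for every convergence space $Y$, every $B\subset Y$ and every filter $\mathcal{G}\in\mathbb{D}(Y)$ that is compact at $B$, the filter $\mathcal{F}\times\mathcal{G}$ is $\mathbb{D}$-compact at $A\times B$; (3) for every $\mathbb{D}$-based atomic topological space $Y$, every $y\in Y$ and every filter $\mathcal{G}$ such that $y\in\lim_Y\mathcal{G}$, the filter $\mathcal{F}\times\mathcal{G}$ is $\mathbb{F}_1$-compact at $A\times\{y\}$.
   Context: Filters are ordered by inclusion ($\mathcal{G}\ge\mathcal{F}$, ''$\mathcal{G}$ is finer than $\mathcal{F}$'', iff $\mathcal{F}\subset\mathcal{G}$). A convergence $\xi$ on a set $X$ is a relation between points of $X$ and (proper) filters on $X$, written $x\in\lim_\xi\mathcal{F}$, such that $\lim\mathcal{F}\subset\lim\mathcal{G}$ if $\mathcal{F}\le\mathcal{G}$, $x\in\lim\{x\}^{\uparrow}$ for all $x$, and $\lim\mathcal{F}\cap\lim\mathcal{G}\subset\lim(\mathcal{F}\wedge\mathcal{G})$ (where $\mathcal F\wedge\mathcal G=\mathcal F\cap\mathcal G$ and $^\uparrow$ denotes closure under supersets). Topological spaces are regarded as convergence spaces. Products carry the product convergence (a filter converges to $(x,y)$ iff its projections converge to $x$ and to $y$). Families $\mathcal{A},\mathcal{B}$ of subsets of $X$ mesh, $\mathcal{A}\#\mathcal{B}$,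 if $A\cap B\ne\varnothing$ for all $A\in\mathcal{A}$, $B\in\mathcal{B}$. The adherence $\mathrm{adh}\,\mathcal{D}$ is the union of the limit sets of all filters finer than $\mathcal{D}$. A class of filters $\mathbb{D}$ assigns to each set $X$ a set $\mathbb{D}(X)$ of filters on $X$; by convention each class also contains the degenerate filter. $\mathbb{F}$ is the class of all filters, $\mathbb{F}_1$ the class of principal filters. A filter $\mathcal{F}$ on a convergence space $X$ is $\mathbb{D}$-compact at $A\subset X$ if $\mathcal{D}\in\mathbb{D}(X)$ and $\mathcal{D}\#\mathcal{F}$ imply $\mathrm{adh}\,\mathcal{D}\cap A\neq\varnothing$; ''compact'' means $\mathbb{F}$-compact. For a filter $\mathcal{H}$ on $X\times Y$ and $\mathcal{F}$ on $X$, $\mathcal{H}(\mathcal{F})$ is the (possibly degenerate) filter on $Y$ generated by the sets $HF=\{y:(x,y)\in H\text{ for some }x\in F\}$, $H\in\mathcal{H}$, $F\in\mathcal{F}$. $\mathbb{D}$ is composable if $\mathcal{H}(\mathcal{F})\in\mathbb{D}(Y)$ for all $X,Y$, $\mathcal{F}\in\mathbb{D}(X)$, $\mathcal{H}\in\mathbb{D}(X\times Y)$. $\mathcal{F}\times\mathcal{G}$ is the filter generated by $\{F\times G:F\in\mathcal{F},G\in\mathcal{G}\}$. A convergence space is $\mathbb{D}$-based if whenever $x\in\lim\mathcal{F}$ there is $\mathcal{D}\in\mathbb{D}$, $\mathcal{D}\le\mathcal{F}$, with $x\in\lim\mathcal{D}$. A topological space is atomic if it has at most one non-isolated point.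
   Formalization: The class 𝔻 is additionally assumed to contain all principal filters (𝔽₁ ⊂ 𝔻); without this the equivalence fails, e.g. for 𝔻(X) consisting only of {X} and the degenerate filter. *)

(* Defs.v *)
From mathcomp Require Import all_boot.
From mathcomp Require Import all_classical topology.

Set Implicit Arguments.
Unset Strict Implicit.
Unset Printing Implicit Defensive.

Local Open Scope classical_set_scope.

(* Filters are set systems satisfying [Filter] (possibly degenerate) or
   [ProperFilter]; "G is finer than F" is [F `<=` G], and F `&` G is the
   infimum of F and G. *)

Record convergence (X : Type) := Convergence {
  clim : set_system X -> set X ;
  clim_proper : forall F x, clim F x -> ProperFilter F ;
  clim_le : forall F G x,
    ProperFilter G -> F `<=` G -> clim F x -> clim G x ;
  clim_point : forall x, clim (principal_filter x) x ;
  clim_meet : forall F G x, clim F x -> clim G x -> clim (F `&` G) x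
}.

Section topological_convergence.
Variable Y : topologicalType.

Definition top_clim (F : set_system Y) : set Y :=
  [set y | ProperFilter F /\ F --> y].

Lemma top_clim_proper F y : top_clim F y -> ProperFilter F.
Proof. by case. Qed.

Lemma top_clim_le F G y :
  ProperFilter G -> F `<=` G -> top_clim F y -> top_clim G y.
Proof. by move=> PG FG [_ Fy]; split=> // A /Fy /FG. Qed.

Lemma top_clim_point y : top_clim (principal_filter y) y.
Proof.
split; first exact: (globally_properfilter (a := y)).
by move=> A /nbhs_singleton Ay z /= ->.
Qed.

Lemma top_clim_meet F G y :
  top_clim F y -> top_clim G y -> top_clim (F `&` G) y.
Proof.
move=> [PF Fy] [PG Gy]; split; last by move=> A nA; split; [exact: Fy|exact: Gy].
apply: Build_ProperFilter_ex.
  by move=> A [FA _]; exact: filter_ex FA.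
split; first by split; exact: filterT.
- by move=> A B [FA GA] [FB GB]; split; exact: filterI.
- by move=> A B AB [FA GA]; split; [exact: filterS FA|exact: filterS GA].
Qed.

Definition top_convergence : convergence Y :=
  Convergence top_clim_proper top_clim_le top_clim_point top_clim_meet.

End topological_convergence.

Section product_convergence.
Variables (X Y : Type) (xi : convergence X) (eta : convergence Y).

Definition prod_clim (F : set_system (X * Y)) : set (X * Y) :=
  [set p | [/\ ProperFilter F, clim xi (fst @ F) p.1 & clim eta (snd @ F) p.2]].

Lemma prod_clim_proper F p : prod_clim F p -> ProperFilter F.
Proof. by case. Qed.

Lemma prod_clim_le F G p :
  ProperFilter G -> F `<=` G -> prod_clim F p -> prod_clim G p.
Proof.
move=> PG FG [_ F1 F2]; split=> //.
- by apply: clim_le F1 => A /FG.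
- by apply: clim_le F2 => A /FG.
Qed.

Lemma prod_clim_point p : prod_clim (principal_filter p) p.
Proof.
have Pp : ProperFilter (principal_filter p).
  exact: (globally_properfilter (a := p)).
split=> //.
- by apply: clim_le (clim_point xi p.1) => A /= Ap q ->; exact: Ap.
- by apply: clim_le (clim_point eta p.2) => A /= Ap q ->; exact: Ap.
Qed.

Lemma prod_clim_meet F G p :
  prod_clim F p -> prod_clim G p -> prod_clim (F `&` G) p.
Proof.
move=> [PF F1 F2] [PG G1 G2]; split; last 2 first.
- exact: clim_meet F1 G1.
- exact: clim_meet F2 G2.
apply: Build_ProperFilter_ex.
  by move=> A [FA _]; exact: filter_ex FA.
split; first by split; exact: filterT.
- by move=> A B [FA GA] [FB GB]; split; exact: filterI.
- by move=> A B AB [FA GA]; split; [exact: filterS FA|exact: filterS GA].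
Qed.

Definition prod_convergence : convergence (X * Y) :=
  Convergence prod_clim_proper prod_clim_le prod_clim_point prod_clim_meet.

End product_convergence.

Definition adherence (X : Type) (xi : convergence X) (E : set_system X) :
  set X := [set x | exists2 G, E `<=` G & clim xi G x].

(* [fc_degenerate]: the degenerate filter, to which every subset belongs. *)
Record class_of_filters := ClassOfFilters {
  fc_mem :> forall X : Type, set (set_system X) ;
  fc_filter : forall (X : Type) (F : set_system X), fc_mem F -> Filter F ;
  fc_degenerate : forall X : Type, fc_mem [set: set X]
}.
Arguments fc_mem : clear implicits.

Lemma all_filters_degenerate (X : Type) : Filter [set: set X].
Proof. by split=> // B C _ _. Qed.

Definition all_filters : class_of_filters :=
  @ClassOfFilters (fun X => [set F : set_system X | Filter F])
    (fun _ _ FF => FF) all_filters_degenerate.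

Lemma principal_filters_filter (X : Type) (F : set_system X) :
  range (@globally X) F -> Filter F.
Proof. by case=> S _ <-; exact: globally_filter. Qed.

Lemma principal_filters_degenerate (X : Type) :
  range (@globally X) [set: set X].
Proof. by exists set0 => //; apply/seteqP; split=> // B _ x. Qed.

Definition principal_filters : class_of_filters :=
  @ClassOfFilters (fun X => range (@globally X))
    principal_filters_filter principal_filters_degenerate.

Definition subclass (D E : class_of_filters) : Prop :=
  forall X : Type, D X `<=` E X.

Definition compact_at (D : class_of_filters) (X : Type) (xi : convergence X)
    (F : set_system X) (A : set X) : Prop :=
  forall E : set_system X, D X E -> E `#` F -> adherence xi E `&` A !=set0.

Definition rel_image (X Y : Type) (H : set (X * Y)) (S : set X) : set Y :=
  [set y | exists2 x, S x & H (x, y)].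

Definition rel_filter (X Y : Type) (H : set_system (X * Y))
    (F : set_system X) : set_system Y :=
  filter_from [set P | H P.1 /\ F P.2] (fun P => rel_image P.1 P.2).

Definition composable (D : class_of_filters) : Prop :=
  forall (X Y : Type) (F : set_system X) (H : set_system (X * Y)),
    D X F -> D (X * Y)%type H -> D Y (rel_filter H F).

Definition based (D : class_of_filters) (X : Type) (xi : convergence X) : Prop :=
  forall (F : set_system X) (x : X), clim xi F x ->
    exists E : set_system X, [/\ D X E, E `<=` F & clim xi E x].

Definition atomic (Y : topologicalType) : Prop :=
  forall y z : Y,
    ~ isolated [set: Y] y -> ~ isolated [set: Y] z -> y = z.

(* Main.v *)
Require Import Defs.
From HB Require Import structures.
From mathcomp Require Import all_boot.
From mathcomp Require Import all_classical topology.

(** The engine of the proof is a duality: a filter E on a product meshes with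
    F x G exactly when the image E(F) meshes with G ([meets_rel_filter]).

    If F is D-compact at A, E is in D and meshes with F x G, then the inverse
    image of G under E is in D by composability and meshes with F, so some
    filter U finer than it converges to a point x of A.  By duality E(U) meshes
    with G, so compactness of G gives a filter W finer than E(U) that converges
    to a point y of B.  By duality again E meshes with U x W, and the supremum of
    these two filters converges to (x, y).

    In a D-based space, a filter that converges to y is finer than some filter of
    D that converges to y, and the latter is compact at {y} ([clim_compact]).
    Compactness passes to finer filters, and D contains the principal filters, so
    the second condition implies the third.

    For the last implication, let E in D mesh with F.  The obvious test space is
    X, made discrete, together with one point at infinity whose neighbourhoods
    are traced by E ([one_point_space]).  It is atomic, and it is D-based by
    composability ([based_one_point]).  The graph of the embedding of X meshes
    with the product of F and the image of E, so it carries a filter U converging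
    to (a, infinity) with a in A.  Because U lives on the graph and its second
    projection tends to infinity, its first projection is finer than E, whence a
    is adherent to E ([compact_of_one_point]). *)

Set Implicit Arguments.
Unset Strict Implicit.
Unset Printing Implicit Defensive.

Local Open Scope classical_set_scope.

(** * Meshing filters and suprema *)

Lemma meets_sub (T : Type) (F F' G G' : set_system T) :
  F `<=` F' -> G `<=` G' -> F' `#` G' -> F `#` G.
Proof. by move=> FF' GG' m A B /FF' FA /GG' GB; exact: m. Qed.

Definition filter_sup (T : Type) (F G : set_system T) : set_system T :=
  filter_from [set P | F P.1 /\ G P.2] (fun P => P.1 `&` P.2).

Lemma filter_sup_proper (T : Type) (F G : set_system T) :
  Filter F -> Filter G -> F `#` G -> ProperFilter (filter_sup F G).
Proof.
move=> FF FG m; apply: filter_from_proper; last first.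
  by case=> P Q [FP GQ]; exact: m.
apply: filter_from_filter; first by exists (setT, setT); split; exact: filterT.
move=> [P Q] [P' Q'] [FP GQ] [FP' GQ'].
exists (P `&` P', Q `&` Q'); first by split; exact: filterI.
by move=> z [[? ?] [? ?]].
Qed.

Lemma filter_sup_subl (T : Type) (F G : set_system T) :
  Filter G -> F `<=` filter_sup F G.
Proof.
by move=> FG S FS; exists (S, setT) => [|z []//]; split=> //; exact: filterT.
Qed.

Lemma filter_sup_subr (T : Type) (F G : set_system T) :
  Filter F -> G `<=` filter_sup F G.
Proof.
by move=> FF S GS; exists (setT, S) => [|z []//]; split=> //; exact: filterT.
Qed.

(** * Images of filters under relations *)

Lemma rel_image_sub (X Y : Type) (H H' : set (X * Y)) (S S' : set X) :
  H `<=` H' -> S `<=` S' -> rel_image H S `<=` rel_image H' S'.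
Proof. by move=> HH SS y [x /SS ? /HH ?]; exists x. Qed.

Lemma rel_filter_filter (X Y : Type) (H : set_system (X * Y))
    (F : set_system X) : Filter H -> Filter F -> Filter (rel_filter H F).
Proof.
move=> FH FF; apply: filter_from_filter.
  by exists (setT, setT); split; exact: filterT.
move=> [P Q] [P' Q'] [HP FQ] [HP' FQ'].
exists (P `&` P', Q `&` Q'); first by split; exact: filterI.
by move=> y Py; split; apply: rel_image_sub Py => z [].
Qed.

(** Both sides say that every H in E contains some (x, y) with x in P and y in
    Q, for all P in F and Q in G. *)
Lemma meets_rel_filter (X Y : Type) (E : set_system (X * Y))
    (F : set_system X) (G : set_system Y) :
  E `#` filter_prod F G <-> rel_filter E F `#` G.
Proof.
split=> m.
- move=> S Q [[H P] [EH FP] sub] GQ.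
  have [||[x y] [Hxy [Px Qy]]] := m H (P `*` Q) => //; first by exists (P, Q).
  by exists y; split=> //; apply: sub; exists x.
- move=> H S EH [[P Q] [FP GQ] sub].
  have [||y [[x Px Hxy] Qy]] := m (rel_image H P) Q => //; first by exists (H, P).
  by exists (x, y); split=> //; exact: sub.
Qed.

Lemma meets_swap (X Y : Type) (E : set_system (X * Y))
    (F : set_system X) (G : set_system Y) :
  (@swap_pair X Y @ E) `#` filter_prod G F <-> E `#` filter_prod F G.
Proof.
split=> m H S EH [[P Q] [FP GQ] sub].
- have [||[y x] [Hxy [Qy Px]]] := m (@swap_pair Y X @^-1` H) (Q `*` P).
  + by rewrite fmapE -comp_preimage (_ : _ \o _ = id) //; apply/funext=> -[].
  + by exists (Q, P).
  + by exists (x, y); split=> //; exact: sub.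
- have [||[x y] [Hxy [Qy Px]]] := m (@swap_pair X Y @^-1` H) (Q `*` P) => //.
    by exists (Q, P).
  by exists (y, x); split=> //; exact: sub.
Qed.

(** * Composable classes *)

(** Apply composability to the principal filter of R: its sets are the supersets
    of R, so the images under R itself generate. *)
Lemma composable_rel_image (D : class_of_filters) (X Y : Type)
    (R : set (X * Y)) (F : set_system X) :
  composable D -> subclass principal_filters D ->
  D X F -> D Y (filter_from F (rel_image R)).
Proof.
move=> compD principalD DF.
have DR : D (X * Y)%type (globally R) by apply: principalD; exists R.
suff <- : rel_filter (globally R) F = filter_from F (rel_image R).
  exact: compD.
apply/seteqP; split=> S.
- case=> -[H P] [RH FP] sub; exists P => //; apply: subset_trans sub.
  by apply: rel_image_sub.
- by case=> P FP sub; exists (R, P) => //; split=> // p.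
Qed.

Lemma composable_image (D : class_of_filters) (X Y : Type) (f : X -> Y)
    (F : set_system X) :
  composable D -> subclass principal_filters D -> D X F -> D Y (f @ F).
Proof.
move=> compD principalD DF; have FF := fc_filter DF.
suff -> : f @ F = filter_from F (rel_image [set p | p.2 = f p.1]).
  exact: composable_rel_image.
apply/seteqP; split=> S.
- by move=> FS; exists (f @^-1` S) => // y [x Sx /= ->].
- case=> P FP sub; rewrite fmapE; apply: filterS FP => x Px.
  by apply: sub; exists x.
Qed.

(** * Products with compact filters *)

Lemma compact_prod (D : class_of_filters) (X Y : Type) (xi : convergence X)
    (eta : convergence Y) (A : set X) (B : set Y) (F : set_system X)
    (G : set_system Y) :
  composable D -> subclass principal_filters D ->
  compact_at D xi F A -> D Y G -> compact_at all_filters eta G B ->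
  compact_at D (prod_convergence xi eta) (filter_prod F G) (A `*` B).
Proof.
move=> compD principalD cF DG cG E DE mE; have FE := fc_filter DE.
have DswapE : D (Y * X)%type (@swap_pair X Y @ E) by exact: composable_image.
have [|x [[U subU Ux] Ax]] := cF _ (compD _ _ _ _ DG DswapE).
  by apply/meets_rel_filter/meets_swap.
have PU := clim_proper Ux.
have mU : rel_filter E U `#` G.
  apply/meets_rel_filter/meets_swap/meets_rel_filter.
  by apply: (@meets_sub _ _ U _ U) => // S T /filterI US /US /filter_ex.
have FEU : Filter (rel_filter E U) by exact: rel_filter_filter.
have [y [[W subW Wy] By]] := cG _ FEU mU.
have PW := clim_proper Wy.
have mW : E `#` filter_prod U W.
  apply/meets_rel_filter.
  by apply: (@meets_sub _ _ W _ W) => // S T /filterI WS /WS /filter_ex.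
have PV := filter_sup_proper FE _ mW.
exists (x, y); split=> //; exists (filter_sup E (filter_prod U W)).
  exact: filter_sup_subl.
split=> /=.
- exact: PV.
- apply: clim_le Ux => S US; apply: filter_sup_subr.
  by exists (S, setT) => [|z []//]; split=> //; exact: filterT.
- apply: clim_le Wy => S WS; apply: filter_sup_subr.
  by exists (setT, S) => [|z []//]; split=> //; exact: filterT.
Qed.

Lemma clim_compact (Y : Type) (eta : convergence Y) (G : set_system Y) (y : Y) :
  clim eta G y -> compact_at all_filters eta G [set y].
Proof.
move=> Gy E FE mE; have PG := clim_proper Gy.
have PS := filter_sup_proper FE _ mE.
exists y; split=> //; exists (filter_sup E G); first exact: filter_sup_subl.
by apply: clim_le Gy; exact: filter_sup_subr.
Qed.

Lemma compact_at_sub (D : class_of_filters) (X : Type) (xi : convergence X)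
    (F G : set_system X) (A : set X) :
  F `<=` G -> compact_at D xi F A -> compact_at D xi G A.
Proof. by move=> FG cF E DE mE; apply: cF => //; apply: meets_sub mE. Qed.

Lemma compact_at_subclass (C D : class_of_filters) (X : Type)
    (xi : convergence X) (F : set_system X) (A : set X) :
  subclass C D -> compact_at D xi F A -> compact_at C xi F A.
Proof. by move=> CD cF E /CD; exact: cF. Qed.

(** * The discrete space with one point at infinity *)

(** [None] is the point at infinity.  The filter is a phantom argument, so that
    each filter on X determines its own topology. *)
Definition one_point_space (X : Type) (E : set_system X) & Filter E : Type :=
  option X.

HB.instance Definition _ (X : Type) (E : set_system X) (FE : Filter E) :=
  gen_eqMixin (one_point_space FE).
HB.instance Definition _ (X : Type) (E : set_system X) (FE : Filter E) :=
  gen_choiceMixin (one_point_space FE).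

Definition one_point_nbhs (X : Type) (E : set_system X) (FE : Filter E)
    (p : one_point_space FE) : set_system (one_point_space FE) :=
  [set S | S p /\ (p = None -> E (Some @^-1` S))].

HB.instance Definition _ (X : Type) (E : set_system X) (FE : Filter E) :=
  hasNbhs.Build (one_point_space FE) (@one_point_nbhs X E FE).

Lemma one_point_nbhs_filter (X : Type) (E : set_system X) (FE : Filter E)
    (p : one_point_space FE) : ProperFilter (nbhs p).
Proof.
apply: Build_ProperFilter_ex; first by move=> S [Sp _]; exists p.
split.
- by split=> // _; exact: filterT.
- move=> S T [Sp ES] [Tp ET]; split=> // p0.
  by apply: filterI; [exact: ES|exact: ET].
- move=> S T ST [Sp ES]; split; first exact: ST.
  by move=> /ES; apply: filterS => x; exact: ST.
Qed.

Lemma one_point_nbhs_singleton (X : Type) (E : set_system X) (FE : Filter E)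
    (p : one_point_space FE) (S : set (one_point_space FE)) :
  nbhs p S -> S p.
Proof. by case. Qed.

Lemma one_point_nbhs_nbhs (X : Type) (E : set_system X) (FE : Filter E)
    (p : one_point_space FE) (S : set (one_point_space FE)) :
  nbhs p S -> nbhs p (nbhs^~ S).
Proof. by move=> [Sp ES]; split=> // /ES; apply: filterS => x Sx; split. Qed.

HB.instance Definition _ (X : Type) (E : set_system X) (FE : Filter E) :=
  Nbhs_isNbhsTopological.Build (one_point_space FE)
    (@one_point_nbhs_filter X E FE) (@one_point_nbhs_singleton X E FE)
    (@one_point_nbhs_nbhs X E FE).

Lemma isolated_Some (X : Type) (E : set_system X) (FE : Filter E) (x : X) :
  isolated [set: one_point_space FE] (Some x).
Proof.
split; first exact/mem_set.
by exists [set Some x]; [split|rewrite setIT].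
Qed.

Lemma atomic_one_point (X : Type) (E : set_system X) (FE : Filter E) :
  atomic (one_point_space FE).
Proof.
by move=> [x|] [z|] // ny nz; [case: ny|case: ny|case: nz]; exact: isolated_Some.
Qed.

(** The neighbourhood filters themselves are in D: at an isolated point they are
    principal, and at infinity they are the image of E under the relation that
    sends x to both x and infinity. *)
Lemma based_one_point (D : class_of_filters) (X : Type) (E : set_system X)
    (FE : ProperFilter E) :
  composable D -> subclass principal_filters D -> D X E ->
  based D (top_convergence (one_point_space FE)).
Proof.
move=> compD principalD DE F y [PF Fy].
exists (nbhs y); split=> //; last by split=> //; exact: nbhs_pfilter.
case: y {Fy} => [x|].
- suff -> : nbhs (Some x : one_point_space FE) = globally [set Some x].
    by apply: principalD; exists [set Some x].
  apply/seteqP; split=> S; first by case=> Sx _ z ->.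
  by move=> Sx; split=> //; exact: Sx.
- pose R : set (X * one_point_space FE) :=
    [set p | p.2 = Some p.1 \/ p.2 = None].
  suff -> : nbhs (None : one_point_space FE) = filter_from E (rel_image R).
    exact: composable_rel_image.
  apply/seteqP; split=> S.
  + case=> S0 /(_ erefl) ES; exists (Some @^-1` S) => //.
    by move=> z [x Sx [] /= ->].
  + case=> P EP sub; split.
      (* properness: the image of an empty P would miss the point at infinity *)
      by have [x Px] := filter_ex EP; apply: sub; exists x => //; right.
    by move=> _; apply: filterS EP => x Px; apply: sub; exists x => //; left.
Qed.

Lemma one_point_limit (X : Type) (E : set_system X) (FE : ProperFilter E) :
  clim (top_convergence (one_point_space FE)) (Some @ E) None.
Proof.
split; first exact: fmap_proper_filter.
by move=> S [_ /(_ erefl)].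
Qed.

(** * Characterizations of relative compactness *)

Lemma compact_of_one_point (X : Type) (xi : convergence X) (A : set X)
    (F E : set_system X) (FE : ProperFilter E) :
  compact_at principal_filters
    (prod_convergence xi (top_convergence (one_point_space FE)))
    (filter_prod F (Some @ E)) (A `*` [set None]) ->
  E `#` F -> adherence xi E `&` A !=set0.
Proof.
move=> cF mE; pose graph : set (X * one_point_space FE) :=
  [set p | p.2 = Some p.1].
have [||[a p] [[U subU [PU Ua Uinf]] [Aa p_inf]]] := cF (globally graph).
- by exists graph.
- move=> H S graphH [[P Q] [FP EQ] sub].
  have [x [Qx Px]] := mE _ _ EQ FP.
  by exists (x, Some x); split; [exact: graphH|exact: sub].
exists a; split=> //; exists (fmap fst U) => // S ES.
move: Uinf; rewrite /= (p_inf : p = None) => -[_ Uinf].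
have UN : U (snd @^-1` (None |` (Some @` S) : set (one_point_space FE))).
  apply: Uinf; split; first by left.
  by move=> _; apply: filterS ES => x Sx; right; exists x.
have Ug : U graph by apply: subU.
apply: filterS (filterI UN Ug) => -[x z] [+ zx]; have {zx} -> : z = Some x := zx.
by case=> // -[w Sw [<-]].
Qed.

Theorem theorem1 (D : class_of_filters) (compD : composable D)
    (principalD : subclass principal_filters D)
    (X : Type) (xi : convergence X) (A : set X)
    (F : set_system X) (FF : Filter F) :
  [<->
    compact_at D xi F A ;
    forall (Y : Type) (eta : convergence Y) (B : set Y) (G : set_system Y),
      D Y G -> compact_at all_filters eta G B ->
      compact_at D (prod_convergence xi eta) (filter_prod F G) (A `*` B) ;
    forall Y : topologicalType, atomic Y -> based D (top_convergence Y) ->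
      forall (y : Y) (G : set_system Y), clim (top_convergence Y) G y ->
      compact_at principal_filters (prod_convergence xi (top_convergence Y))
        (filter_prod F G) (A `*` [set y])
  ].
Proof.
tfae.
- by move=> cF Y eta B G; exact: compact_prod.
- move=> cprod Y _ basedY y G /basedY[E [DE EG Ey]].
  apply: compact_at_subclass principalD _.
  apply: (@compact_at_sub _ _ _ (filter_prod F E)); last first.
    by apply: cprod => //; exact: clim_compact.
  by move=> S [P [FP EP] sub]; exists P => //; split=> //; exact: EG.
- move=> cprod E DE mE; have FE := fc_filter DE.
  have PE : ProperFilter E.
    apply: Build_ProperFilter_ex => P EP.
    by have [x []] := mE _ _ EP filterT; exists x.
  apply: (@compact_of_one_point _ _ _ F _ PE) => //.
  apply: cprod; first exact: atomic_one_point.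
  + exact: based_one_point.
  + exact: one_point_limit.
Qed.
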